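(* For all integers $n=n_1+n_2$ and $k=k_1+k_2$ with $0\le k_1\le n_1$ and $0\le k_2\le n_2$, we have $E_k(n)\le E_{k_1}(n_1)+E_{k_2}(n_2)$.
   Context: $[n]=\{1,\dots,n\}$ and $\binom{[n]}{k}$ is the set of $k$-element subsets of $[n]$. For integers $0\le k\le n$ and a function $f:\binom{[n]}{k}\to\{0,1\}$, the deterministic query complexity $D_k(f)$ is the minimum number $q$ such that there is a deterministic adaptive algorithm which, for every $A\in\binom{[n]}{k}$ (with $f$, $n$, $k$ known, $A$ unknown), correctly computes $f(A)$ using at most $q$ queries, where a query is an element $i\in[n]$ and its answer is whether $i\in A$ or $i\notin A$. Let $D_k(n)=\max\{D_k(f) : f:\binom{[n]}{k}\to\{0,1\}\}$ and $E_k(n)=n-D_k(n)$. *)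

(* Defs.v *)
From mathcomp Require Import all_boot all_order all_algebra.
From mathcomp Require Import boolp.

Set Implicit Arguments.
Unset Strict Implicit.
Unset Printing Implicit Defensive.

(* The ground set [n] = {1, ..., n} is represented by 'I_n = {0, ..., n-1}. *)
Notation ksubset n k := {A : {set 'I_n} | #|A| == k}.

(* A deterministic adaptive algorithm is a binary decision tree:
   [Query i yes no] asks whether i \in A, and continues with [yes] if i \in A
   and with [no] otherwise. *)
Inductive decision_tree (n : nat) : Type :=
| Answer of bool
| Query of 'I_n & decision_tree n & decision_tree n.

Arguments Answer {n} b.

Fixpoint output n (t : decision_tree n) (A : {set 'I_n}) : bool :=
  match t with
  | Answer b => b
  | Query i yes no => if i \in A then output yes A else output no A
  end.

Fixpoint queries n (t : decision_tree n) (A : {set 'I_n}) : nat :=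
  match t with
  | Answer _ => 0
  | Query i yes no => (if i \in A then queries yes A else queries no A).+1
  end.

Definition computes_within n k (t : decision_tree n)
    (f : {ffun ksubset n k -> bool}) (q : nat) : Prop :=
  forall A : ksubset n k, output t (val A) = f A /\ queries t (val A) <= q.

Definition computable_within n k (f : {ffun ksubset n k -> bool}) (q : nat) :
    Prop :=
  exists t : decision_tree n, computes_within t f q.

(* The tree that queries every element of s, collecting in B the elements found
   to belong to the input, and finally answers g B. *)
Fixpoint query_all n (g : {set 'I_n} -> bool) (s : seq 'I_n) (B : {set 'I_n}) :
    decision_tree n :=
  if s is i :: s' then Query i (query_all g s' (i |: B)) (query_all g s' B)
  else Answer (g B).

Lemma output_query_all n g s (A B : {set 'I_n}) :
  output (query_all g s B) A = g (B :|: [set i in s | i \in A]).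
Proof.
elim: s B => [|i s IHs] B /=.
  by congr g; apply/setP => x; rewrite !inE orbF.
case: ifP => Ai; rewrite IHs; congr g; apply/setP => x; rewrite !inE.
  by case: eqVneq => [->|_]; rewrite ?Ai //= ?orbT.
by case: eqVneq => [->|_] //=; rewrite Ai !andbF.
Qed.

Lemma queries_query_all n g s (A B : {set 'I_n}) :
  queries (query_all g s B) A = size s.
Proof. by elim: s B => //= i s IHs B; case: ifP => _; rewrite IHs. Qed.

Lemma computable_within_card n k (f : {ffun ksubset n k -> bool}) :
  computable_within f n.
Proof.
pose g (B : {set 'I_n}) := if insub B is Some A then f A else false.
exists (query_all g (enum 'I_n) set0) => A; split.
  rewrite output_query_all set0U.
  have -> : [set i in enum 'I_n | i \in val A] = val A.
    by apply/setP => i; rewrite !inE mem_enum.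
  by rewrite /g valK.
by rewrite queries_query_all size_enum_ord.
Qed.

Lemma ex_computable_within n k (f : {ffun ksubset n k -> bool}) :
  exists q, `[< computable_within f q >].
Proof. by exists n; apply/asboolP/computable_within_card. Qed.

(* D_k(f) *)
Definition query_complexity n k (f : {ffun ksubset n k -> bool}) : nat :=
  ex_minn (ex_computable_within f).

(* D_k(n) *)
Definition max_query_complexity (k n : nat) : nat :=
  \max_(f : {ffun ksubset n k -> bool}) query_complexity f.

(* E_k(n) *)
Definition query_saving (k n : nat) : int :=
  (n%:Z - (max_query_complexity k n)%:Z)%R.

(* Main.v *)
(* Let f1, f2 be hardest functions for (n1, k1) and (n2, k2).  Their exclusive
   or, as a function of the two halves of A, needs D(f1) + D(f2) queries: on a
   product of promises P1 x P2, a tree for the exclusive or yields separate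
   trees for f1 on P1 and f2 on P2 whose costs add up to at most its own cost.
   When the root queries an element of the first half, both answers give such
   pairs by induction; we take the pair with the larger first cost, and pay one
   more query in the tree for f1, whereas the tree for f2 is reused as it is.
   At a leaf the exclusive or is constant, hence so are f1 and f2. *)
Require Import Defs.
From mathcomp Require Import all_boot all_order all_algebra.
From mathcomp Require Import boolp zify.

Set Implicit Arguments.
Unset Strict Implicit.
Unset Printing Implicit Defensive.

(** The promise [P] is an arbitrary family rather than a slice, so that restricting it by the answer
    to a query stays within the notion. *)
Definition computable_on n (P : {set {set 'I_n}}) (g : {set 'I_n} -> bool)
    (q : nat) : Prop :=
  exists t : decision_tree n,
    forall A, A \in P -> output t A = g A /\ queries t A <= q.

Lemma computable_on_query n (P : {set {set 'I_n}}) g q i :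
  computable_on [set A in P | i \in A] g q ->
  computable_on [set A in P | i \notin A] g q ->
  computable_on P g q.+1.
Proof.
move=> [ty Hy] [tn Hn]; exists (Query i ty tn) => A PA /=.
case: ifP => iA; rewrite ltnS.
  by apply: Hy; rewrite inE PA.
by apply: Hn; rewrite inE PA iA.
Qed.

Lemma computable_on_leq n (P : {set {set 'I_n}}) g q q' :
  q <= q' -> computable_on P g q -> computable_on P g q'.
Proof.
move=> le_qq' [t Ht]; exists t => A /Ht[-> le_q].
by split=> //; apply: leq_trans le_qq'.
Qed.

Lemma computable_on_const n (P : {set {set 'I_n}}) g b :
  {in P, forall A, g A = b} -> computable_on P g 0.
Proof. by move=> gb; exists (Answer b) => A /gb->. Qed.

Definition computable_on_pair m n (P : {set {set 'I_m}}) g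
    (Q : {set {set 'I_n}}) h (q : nat) : Prop :=
  exists q1 q2, [/\ q1 + q2 <= q, computable_on P g q1 & computable_on Q h q2].

Lemma computable_on_pairC m n (P : {set {set 'I_m}}) g
    (Q : {set {set 'I_n}}) h q :
  computable_on_pair P g Q h q -> computable_on_pair Q h P g q.
Proof. by move=> [q1 [q2 [le_q H1 H2]]]; exists q2, q1; rewrite addnC. Qed.

(* If one answer is impossible, the query is void and the nonempty side alone
   provides the pair. *)
Lemma computable_on_pair_query m n (P : {set {set 'I_m}}) g
    (Q : {set {set 'I_n}}) h q i :
  P != set0 ->
  ([set A in P | i \in A] != set0 ->
     computable_on_pair [set A in P | i \in A] g Q h q) ->
  ([set A in P | i \notin A] != set0 ->
     computable_on_pair [set A in P | i \notin A] g Q h q) ->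
  computable_on_pair P g Q h q.+1.
Proof.
move=> P0 Hy Hn.
have sub (R : pred {set 'I_m}) :
    [set A in P | R A] = set0 -> [set A in P | ~~ R A] = P.
  move=> R0; apply/setP => A; move/setP/(_ A): R0; rewrite !inE.
  by case: (A \in P) => //= ->.
have weak : computable_on_pair P g Q h q -> computable_on_pair P g Q h q.+1.
  by move=> [q1 [q2 [le_q H1 H2]]]; exists q1, q2; split=> //; apply: leqW.
have [y0|yn0] := eqVneq [set A in P | i \in A] set0.
  by apply: weak; move: Hn; rewrite (sub (fun A => i \in A)) //; apply.
have [n0|nn0] := eqVneq [set A in P | i \notin A] set0.
  apply: weak; have Py : [set A in P | i \in A] = P.
    rewrite -[RHS](sub _ n0).
    by apply/setP => A; rewrite !inE negbK.
  by move: Hy; rewrite Py; apply.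
have [q1 [q2 [le_q H1 H2]]] := Hy yn0.
have [r1 [r2 [le_r K1 K2]]] := Hn nn0.
(* Either tree for [h] is correct on all of [Q], so the one paired with the larger cost for [g] can
   be kept. *)
have [le_qr|/ltnW le_rq] := leqP q1 r1.
  exists r1.+1, r2; split=> //.
  exact: computable_on_query (computable_on_leq le_qr H1) K1.
exists q1.+1, q2; split=> //.
exact: computable_on_query H1 (computable_on_leq le_rq K1).
Qed.

Definition join_set m n (A : {set 'I_m}) (B : {set 'I_n}) : {set 'I_(m + n)} :=
  [set i | match split i with inl j => j \in A | inr j => j \in B end].

Lemma lshift_join_set m n (A : {set 'I_m}) (B : {set 'I_n}) j :
  (lshift n j \in join_set A B) = (j \in A).
Proof. by rewrite inE (unsplitK (inl j)). Qed.

Lemma rshift_join_set m n (A : {set 'I_m}) (B : {set 'I_n}) j :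
  (rshift m j \in join_set A B) = (j \in B).
Proof. by rewrite inE (unsplitK (inr j)). Qed.

Lemma card_join_set m n (A : {set 'I_m}) (B : {set 'I_n}) :
  #|join_set A B| = #|A| + #|B|.
Proof.
rewrite -!sum1_card big_mkcond big_split_ord /=.
rewrite [in RHS]big_mkcond [X in _ = _ + X]big_mkcond.
by congr (_ + _); apply: eq_bigr => i _;
  rewrite ?lshift_join_set ?rshift_join_set.
Qed.

(** Nonemptiness is essential: with [Q] empty the assumption on [t] is vacuous, however hard [g] is
    on [P]. *)
Lemma computable_on_pair_xor m n (t : decision_tree (m + n))
    (P : {set {set 'I_m}}) g (Q : {set {set 'I_n}}) h q :
  P != set0 -> Q != set0 ->
  (forall A B, A \in P -> B \in Q ->
     output t (join_set A B) = g A (+) h B /\ queries t (join_set A B) <= q) ->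
  computable_on_pair P g Q h q.
Proof.
elim: t P Q q => [b|i ty IHy tn IHn] P Q q P0 Q0 Ht.
  have [/set0Pn[A0 PA0] /set0Pn[B0 QB0]] := (P0, Q0).
  exists 0, 0; split=> //.
    (* Fixing [B0] in the other half forces [g A (+) h B0 = b] for every [A] in [P]. *)
    apply: (@computable_on_const _ _ _ (b (+) h B0)) => A PA.
    by have [/= -> _] := Ht A B0 PA QB0; rewrite addbK.
  apply: (@computable_on_const _ _ _ (b (+) g A0)) => B QB.
  by have [/= -> _] := Ht A0 B PA0 QB; rewrite addbC addKb.
(* A zero budget is absurd: some pair of inputs exists, and the root already costs one query. *)
case: q Ht => [|q] Ht.
  have [/set0Pn[A0 PA0] /set0Pn[B0 QB0]] := (P0, Q0).
  by have [] := Ht A0 B0 PA0 QB0.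
case: (split_ordP i) Ht => j -> Ht.
  apply: (@computable_on_pair_query _ _ _ _ _ _ _ j) => // R0.
    apply: IHy => // A B; rewrite inE => /andP[PA jA] QB.
    by have := Ht A B PA QB; rewrite /= lshift_join_set jA.
  apply: IHn => // A B; rewrite inE => /andP[PA /negbTE jA] QB.
  by have := Ht A B PA QB; rewrite /= lshift_join_set jA.
(* For a query in the second half the roles swap: the costs for [h] are compared. *)
apply: computable_on_pairC.
apply: (@computable_on_pair_query _ _ _ _ _ _ _ j) => // R0.
  apply/computable_on_pairC/IHy => // A B PA; rewrite inE => /andP[QB jB].
  by have := Ht A B PA QB; rewrite /= rshift_join_set jB.
apply/computable_on_pairC/IHn => // A B PA; rewrite inE => /andP[QB /negbTE jB].
by have := Ht A B PA QB; rewrite /= rshift_join_set jB.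
Qed.

(** The value off the slice is arbitrary: promises keep inputs on it. *)
Definition extend_false n k (f : {ffun ksubset n k -> bool}) (A : {set 'I_n}) :
    bool :=
  if insub A is Some B then f B else false.

Lemma query_complexity_leq n k (f : {ffun ksubset n k -> bool}) q :
  computable_on [set A : {set 'I_n} | #|A| == k] (extend_false f) q ->
  query_complexity f <= q.
Proof.
move=> [t Ht]; rewrite /query_complexity; case: ex_minnP => r _; apply.
apply/asboolP; exists t => A; have := Ht (val A).
by rewrite inE (valP A) /extend_false valK; apply.
Qed.

Lemma query_complexity_computable n k (f : {ffun ksubset n k -> bool}) :
  computable_within f (query_complexity f).
Proof. by rewrite /query_complexity; case: ex_minnP => r /asboolP. Qed.

Lemma max_query_complexity_attained n k :
  exists f : {ffun ksubset n k -> bool},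
    max_query_complexity k n = query_complexity f.
Proof.
have F0 : 0 < #|{ffun ksubset n k -> bool}|.
  by apply/card_gt0P; exists [ffun=> false].
by have [f max_f] := eq_bigmax (@query_complexity n k) F0; exists f.
Qed.

Lemma slice_neq0 n k : k <= n -> [set A : {set 'I_n} | #|A| == k] != set0.
Proof. by rewrite -card_gt0 card_draws card_ord bin_gt0. Qed.

Lemma leq_max_query_complexityD n1 n2 k1 k2 : k1 <= n1 -> k2 <= n2 ->
  max_query_complexity k1 n1 + max_query_complexity k2 n2
    <= max_query_complexity (k1 + k2) (n1 + n2).
Proof.
move=> hk1 hk2.
have [f1 ->] := max_query_complexity_attained n1 k1.
have [f2 ->] := max_query_complexity_attained n2 k2.
(* The halves of [A] need not have sizes [k1] and [k2]; [extend_false] covers the other splits. The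
   lower bound uses only the joins of a [k1]-set and a [k2]-set. *)
pose f := [ffun A : ksubset (n1 + n2) (k1 + k2) =>
  extend_false f1 [set j | lshift n2 j \in val A] (+)
  extend_false f2 [set j | rshift n1 j \in val A]].
apply: leq_trans (leq_bigmax f).
have [t Ht] := query_complexity_computable f.
have [||A B|q1 [q2 [le_q H1 H2]]] := @computable_on_pair_xor _ _ t
    [set A : {set 'I_n1} | #|A| == k1] (extend_false f1)
    [set A : {set 'I_n2} | #|A| == k2] (extend_false f2) (query_complexity f).
- exact: slice_neq0.
- exact: slice_neq0.
- rewrite !inE => /eqP cA /eqP cB.
  have cAB : #|join_set A B| == k1 + k2 by rewrite card_join_set cA cB.
  have [/= -> le_q] := Ht (Sub (join_set A B) cAB); split=> //.
  rewrite ffunE /=; congr (extend_false f1 _ (+) extend_false f2 _);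
    by apply/setP => j; rewrite inE ?lshift_join_set ?rshift_join_set.
- by apply: leq_trans le_q; apply: leq_add; apply: query_complexity_leq.
Qed.

Theorem lemma1p4 (n n1 n2 k k1 k2 : nat)
  (hn : n = n1 + n2) (hk : k = k1 + k2)
  (hk1 : 0 <= k1 <= n1) (hk2 : 0 <= k2 <= n2) :
  (query_saving k n <= query_saving k1 n1 + query_saving k2 n2)%R.
Proof.
rewrite {}hn {}hk /query_saving.
have := leq_max_query_complexityD hk1 hk2.
lia.
Qed.
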